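(* Let $X$ be a Fréchet sequence space over $\mathbb{Z}$ in which the sequence $(e_n)_{n\in\mathbb{Z}}$ of canonical vectors is an unconditional basis, let $(\|\cdot\|_k)_{k\in\mathbb{N}}$ be an increasing sequence of seminorms that induces the topology of $X$, and suppose that the bilateral weighted forward shift $F_w$, $w\in\mathbb{K}^{\mathbb{Z}}$, is an invertible operator on $X$. Suppose furthermore that: (1) for every $x\in X$ and $a\in\mathbb{K}^{\mathbb{Z}}$, if $(a(i)x(i))_{i\in\mathbb{Z}}\in X$, then for every $k\in\mathbb{N}$ we have $\|(a(i)x(i))_{i\in\mathbb{Z}}\|_k\ge\big(\inf_{i\in\mathbb{Z}}|a(i)|\big)\|x\|_k$; (2) for every $k,l\in\mathbb{N}$ there is $c>0$ such that for every $n\in\mathbb{Z}$ and every $x=(x_i)_{i\in\mathbb{Z}}\in\overline{\mathrm{span}}\{e_i:\|e_i\|_k\neq 0\}$ we have $$\Big\|\sum_{i\in\mathbb{Z}}x_ie_{i+n}\Big\|_l\ \ge\ c\,\Big\|\sum_{i\in\mathbb{Z}}x_i\frac{\|e_{i+n}\|_l}{\|e_i\|_k}e_i\Big\|_k .$$ Then the following are equivalent: (i) $F_w$ is uniformly topologically expansive. (ii) For every $k\in\mathbb{N}$ there are $l\in\mathbb{N}$ and sets $I_+,I_-$ with $I_+\cup I_-=\{i\in\mathbb{Z}:\|e_i\|_k\neq0\}$ such that $$|w_{i+n-1}\cdots w_i|\,\frac{\|e_{i+n}\|_l}{\|e_i\|_k}=\Big\|F_w^n\Big(\frac{e_i}{\|e_i\|_k}\Big)\Big\|_l\to\infty\quad\text{uniformly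 on } I_+ \text{ as } n\to\infty,$$ $$|w_{i-n}\cdots w_{i-1}|^{-1}\,\frac{\|e_{i-n}\|_l}{\|e_i\|_k}=\Big\|F_w^{-n}\Big(\frac{e_i}{\|e_i\|_k}\Big)\Big\|_l\to\infty\quad\text{uniformly on } I_- \text{ as } n\to\infty.$$
   Context: $\mathbb{K}\in\{\mathbb{R},\mathbb{C}\}$. A Fréchet sequence space over $\mathbb{Z}$ is a linear subspace $X$ of $\mathbb{K}^{\mathbb{Z}}$ carrying a topology that makes it a Fréchet space and for which the inclusion $X\hookrightarrow\mathbb{K}^{\mathbb{Z}}$ is continuous. $e_n=(\delta_{n,j})_{j\in\mathbb{Z}}$, with $\delta_{n,j}$ the Kronecker delta. If all $e_n\in X$, they form a basis of $X$ if every $x=(x_n)\in X$ is the limit in $X$, as $m,n\to\infty$, of $(\dots,0,x_{-m},\dots,x_n,0,\dots)$. The basis is unconditional if the family of projections $P_I$, $I\subset\mathbb{Z}$, where $(P_Ix)(n)=x(n)$ for $n\in I$ and $0$ otherwise, is uniformly bounded. In the right-hand sum of (2), any index $i$ with $\|e_i\|_k=0$ has $x_i=0$, and the corresponding term is read as $0$. The bilateral weighted forward shift is $F_w((x_n)_{n\in\mathbb{Z}})=(w_{n-1}x_{n-1})_{n\in\mathbb{Z}}$, so $F_we_i=w_ie_{i+1}$; it is considered as an operator on $X$ when $F_w(X)\subset X$. Uniform topological expansivity: Let the topology of a locally convex space $X$ be induced by a directed family $(\|\cdot\|_\alpha)_{\alpha\in I}$ of seminorms (in the theorem, the family $(\|\cdot\|_k)_{k\in\mathbb{N}}$).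 An invertible linear operator $T$ on $X$ is uniformly topologically expansive if for every $\alpha\in I$ there is $\beta\in I$ such that $S_\alpha=\{x\in X:\|x\|_\alpha=1\}$ can be written as $S_\alpha=A_\alpha\cup B_\alpha$ with $\|T^nx\|_\beta\to\infty$ uniformly on $A_\alpha$ and $\|T^{-n}x\|_\beta\to\infty$ uniformly on $B_\alpha$ as $n\to\infty$. *)

(* Defs.v *)
From HB Require Import structures.
From mathcomp Require Import all_boot all_order all_algebra.
From mathcomp Require Import all_classical all_reals all_analysis.
From mathcomp Require Import complex.

Set Implicit Arguments.
Unset Strict Implicit.
Unset Printing Implicit Defensive.

Import Order.TTheory GRing.Theory Num.Theory.
Import numFieldNormedType.Exports.

Local Open Scope classical_set_scope.
Local Open Scope ring_scope.

Variant scalar_kind := RealScalars | ComplexScalars.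

Definition scalar_field (R : realType) (s : scalar_kind) : numFieldType :=
  match s with
  | RealScalars => R : numFieldType
  | ComplexScalars => R[i] : numFieldType
  end.

(* [`|z|] lives in the scalar field itself in MathComp; seminorms and moduli
   are R-valued here, hence [modulus] and the embedding [of_real]. *)
Definition modulus (R : realType) (s : scalar_kind) : scalar_field R s -> R :=
  match s return scalar_field R s -> R with
  | RealScalars => fun x : R => `|x|
  | ComplexScalars => fun z : R[i] => ComplexField.Normc.normc z
  end.

Definition of_real (R : realType) (s : scalar_kind) : R -> scalar_field R s :=
  match s return R -> scalar_field R s with
  | RealScalars => fun x : R => x
  | ComplexScalars => fun x : R => x%:C%C
  end.
Arguments of_real {R} s x.

Section LocallyConvex.
Variables (R : realType) (s : scalar_kind).
Let K := scalar_field R s.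
Variable X : topologicalLmodType K.

Record seminorm (p : X -> R) : Prop := Seminorm {
  seminorm_ge0 : forall x, 0 <= p x ;
  seminormD : forall x y, p (x + y) <= p x + p y ;
  seminormZ : forall (a : K) x, p (a *: x) = modulus a * p x
}.

(* Since the sequence is increasing, the sets {y | p k (y - x) < r} already
   form a filter base; no finite intersections are needed. *)
Record induced_by_seminorms (p : nat -> X -> R) : Prop := InducedBySeminorms {
  induced_seminorm : forall k, seminorm (p k) ;
  induced_increasing :
    forall k l : nat, (k <= l)%N -> forall x, p k x <= p l x ;
  induced_nbhs : forall (x : X) (U : set X), nbhs x U <->
    exists k (r : R), 0 < r /\ [set y | p k (y - x) < r] `<=` U
}.

(* Cauchy with respect to the translation-invariant uniformity of X. *)
Definition lin_cauchy (F : set_system X) : Prop :=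
  forall U : set X, nbhs 0 U ->
    exists2 A, F A & forall x y, A x -> A y -> U (x - y).

Record frechet_space : Prop := FrechetSpace {
  frechet_hausdorff : hausdorff_space X ;
  frechet_seminorms : exists p, induced_by_seminorms p ;
  frechet_complete : forall F : set_system X,
    ProperFilter F -> lin_cauchy F -> exists x : X, F --> x
}.

Definition lin_span (S : set X) : set X :=
  [set x | exists n (a : 'I_n -> K) (v : 'I_n -> X),
    (forall j, S (v j)) /\ x = \sum_(j < n) a j *: v j].

(* y is the limit of \sum_(-m <= i <= n) u i as m and n tend independently to
   infinity. *)
Definition is_sumZ (u : int -> X) (y : X) : Prop :=
  (fun mn : nat * nat => \sum_(j < (mn.1 + mn.2).+1) u (j%:Z - mn.1%:Z))
    @ filter_prod \oo \oo --> y.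

Definition unif_to_pinfty (T : Type) (A : set T) (f : nat -> T -> R) : Prop :=
  forall M : R, \forall n \near \oo, forall t, A t -> M < f n t.

(* Tinv is the inverse of T; the seminorms p form the directed family. *)
Definition unif_top_expansive (I : Type) (p : I -> X -> R)
    (T Tinv : X -> X) : Prop :=
  forall k, exists l (A B : set X),
    [/\ [set x | p k x = 1] = A `|` B,
        unif_to_pinfty A (fun n x => p l (iter n T x)) &
        unif_to_pinfty B (fun n x => p l (iter n Tinv x))].

(* X is identified with a linear subspace of K^Z through the inclusion J. *)
Record frechet_sequence_space (J : {linear X -> (int -> K^o)}) : Prop :=
  FrechetSequenceSpace {
  seqspace_frechet : frechet_space ;
  seqspace_inj : injective J ;
  seqspace_continuous :
    continuous (J : X -> prod_topology (fun _ : int => K^o))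
}.

Definition canonical_vectors (J : X -> int -> K) (e : int -> X) : Prop :=
  forall n j, J (e n) j = (n == j)%:R.

Definition canonical_basis (J : X -> int -> K) (e : int -> X) : Prop :=
  canonical_vectors J e /\ forall x, is_sumZ (fun i => J x i *: e i) x.

(* Uniform boundedness of (P_I) as a family of operators: equicontinuity. *)
Definition unconditional_basis (J : X -> int -> K) (e : int -> X) : Prop :=
  canonical_basis J e /\
  exists P : set int -> X -> X,
    (forall I x n, J (P I x) n = if n \in I then J x n else 0) /\
    (forall U : set X, nbhs 0 U ->
      exists2 V : set X, nbhs 0 V & forall I x, V x -> U (P I x)).

Definition wshift (w x : int -> K) : int -> K :=
  fun n => w (n - 1) * x (n - 1).

(* T is F_w restricted to X (so that F_w(X) is included in X), Tinv its inverse.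
   Continuity of both is automatic by the closed graph theorem. *)
Definition invertible_wshift (J : X -> int -> K) (w : int -> K)
    (T Tinv : X -> X) : Prop :=
  [/\ forall x, J (T x) = wshift w (J x), cancel T Tinv & cancel Tinv T].

End LocallyConvex.

(* Main.v *)
(* Hypothesis (1) makes every coordinate projection P_I a contraction for every
   seminorm, and P_I x vanishes in the k-th seminorm when I avoids
   {i | p k (e i) != 0}.  Hence a vector of the k-unit sphere has a part of size
   at least 1/2 supported on I_+ or on I_-.  Hypothesis (2) compares the orbit of
   that part with its multiple by the scalar orbits of the e_i, and hypothesis
   (1) bounds this multiple from below uniformly.  Conversely, the normalised
   canonical vectors lie on the unit sphere, so a splitting of the sphere induces
   one of the index set. *)
Require Import Defs.
From mathcomp Require Import all_boot all_order all_algebra.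
From mathcomp Require Import all_classical all_reals all_analysis.
From mathcomp Require Import complex zify lra.

Set Implicit Arguments.
Unset Strict Implicit.
Unset Printing Implicit Defensive.

Import Order.TTheory GRing.Theory Num.Theory.
Import numFieldNormedType.Exports.

Local Open Scope classical_set_scope.
Local Open Scope ring_scope.

(** * The modulus, for both scalar fields at once *)

Section Modulus.
Context {R : realType} {s : scalar_kind}.
Implicit Types x y : scalar_field R s.

Lemma modulus0 : modulus (0 : scalar_field R s) = 0.
Proof. by case: s; [exact: normr0|exact: ComplexField.Normc.normc0]. Qed.

Lemma modulus1 : modulus (1 : scalar_field R s) = 1.
Proof. by case: s; [exact: normr1|exact: ComplexField.Normc.normc1]. Qed.

Lemma modulusM x y : modulus (x * y) = modulus x * modulus y.
Proof.
by case: s x y; [exact: normrM|exact: ComplexField.Normc.normcM].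
Qed.

Lemma modulusV x : modulus x^-1 = (modulus x)^-1.
Proof. by case: s x; [exact: normfV|exact: ComplexField.Normc.normcV]. Qed.

Lemma modulus_ge0 x : 0 <= modulus x.
Proof.
case: s x => /= [x|[a b]]; first exact: normr_ge0.
exact: sqrtr_ge0.
Qed.

Lemma modulus_of_real (r : R) : 0 <= r -> modulus (of_real s r) = r.
Proof.
case: s => /= r0; first by rewrite ger0_norm.
by rewrite expr0n /= addr0 sqrtr_sqr ger0_norm.
Qed.

End Modulus.

(** * Coordinates, seminorms and truncations *)

Section SequenceSpace.
Context {R : realType} {s : scalar_kind}.
Notation K := (scalar_field R s).
Context {X : topologicalLmodType K} {J : {linear X -> (int -> K^o)}}.
Context {e : int -> X} {p : nat -> X -> R}.
Hypothesis Jinj : injective J.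
Hypothesis Je : canonical_vectors J e.
Hypothesis Jbasis : forall x, is_sumZ (fun i => J x i *: e i) x.
Hypothesis hp : induced_by_seminorms p.

Lemma coord_inj (x y : X) : (forall i, J x i = J y i) -> x = y.
Proof. by move=> xy; apply: Jinj; apply/funext. Qed.

Lemma coordD (x y : X) i : J (x + y) i = J x i + J y i.
Proof. by rewrite linearD. Qed.

Lemma coordZ (a : K) (x : X) i : J (a *: x) i = a * J x i.
Proof. by rewrite linearZ. Qed.

Lemma coord_sum n (F : 'I_n -> X) i :
  J (\sum_(j < n) F j) i = \sum_(j < n) J (F j) i.
Proof. by rewrite linear_sum fct_sumE. Qed.

Lemma seminorm0 k : p k 0 = 0.
Proof.
by rewrite -(scale0r 0) (seminormZ (induced_seminorm hp k)) modulus0 mul0r.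
Qed.

Lemma seminormB k x y : p k x <= p k y + p k (y - x).
Proof.
rewrite -{1}(subKr y x); apply: le_trans (seminormD (induced_seminorm hp k) _ _) _.
rewrite lerD2l -scaleN1r (seminormZ (induced_seminorm hp k)).
suff -> : modulus (-1 : K) = 1 by rewrite mul1r.
(* By multiplicativity the modulus of -1 squares to 1; nonnegativity then excludes the value -1. *)
have /eqP := modulusM (-1 : K) (-1).
rewrite mulrNN mulr1 modulus1 eq_sym -expr2 sqrf_eq1 => /orP[/eqP//|/eqP h].
by have := modulus_ge0 (-1 : K); rewrite h; lra.
Qed.

(** The offset [d] lets one formula serve for truncations of a vector ([d = 0]) and for those of the
    translated series in hypothesis (2). *)
Definition partial_sum (d : int) (m n : nat) (c : int -> K) : X :=
  \sum_(j < (m + n).+1) c (j%:Z - m%:Z) *: e (j%:Z - m%:Z + d).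

Lemma coord_partial_sum d m n (c : int -> K) (i : int) :
  J (partial_sum d m n c) (i + d) = if - m%:Z <= i <= n%:Z then c i else 0.
Proof.
rewrite coord_sum; case: ifPn => hi.
  have lt_j : (absz (i + m%:Z)%R < (m + n).+1)%N by lia.
  have jE : (absz (i + m%:Z))%:Z - m%:Z = i by lia.
  rewrite (bigD1 (Ordinal lt_j)) //= big1 ?addr0.
    by rewrite coordZ Je jE eqxx mulr1.
  move=> j /eqP neq_j; rewrite coordZ Je.
  case: eqP => [E|_]; last by rewrite mulr0.
  by case: neq_j; apply: val_inj => /=; lia.
apply: big1 => j _; rewrite coordZ Je; case: eqP => [E|_]; last by rewrite mulr0.
by have := ltn_ord j; lia.
Qed.

(** Once the window contains the support of [c], the partial sum has the coordinates of [y], hence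
    equals [y]: the limit is that of an eventually constant map. *)
Lemma is_sumZ_finite d N (c : int -> K) (y : X) :
  (forall i, ~~ (- N%:Z <= i <= N%:Z) -> c i = 0) ->
  (forall i, J y (i + d) = c i) ->
  is_sumZ (fun i => c i *: e (i + d)) y.
Proof.
move=> c0 yE; apply: cvg_near_cst.
exists ([set m | (N <= m)%N], [set n | (N <= n)%N]).
  by split; exists N.
move=> [m n] /= [Nm Nn].
apply: coord_inj => i; rewrite -(subrK d i) yE.
rewrite -/(partial_sum d m n c) coord_partial_sum.
by case: ifPn => // hi; rewrite c0 //; lia.
Qed.

Lemma partial_sum_approx k (x : X) (eps : R) : 0 < eps ->
  exists N, p k (partial_sum 0 N N (J x) - x) < eps.
Proof.
move=> eps0; have U : nbhs x [set y | p k (y - x) < eps].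
  by apply/(induced_nbhs hp); exists k, eps; split.
have [[A B] /= [[a _ Aa] [b _ Bb]] AB] := Jbasis U.
exists (maxn a b).
have /AB/= : (A `*` B) (maxn a b, maxn a b).
  by split; [apply: Aa; rewrite /= leq_maxl | apply: Bb; rewrite /= leq_maxr].
congr (p k (_ - x) < eps); apply: eq_bigr => j _.
by rewrite addr0.
Qed.

(** Truncations approximate [x] in [p k] to within [eps / C], so a bound common to all of them
    passes to [x]. *)
Lemma seminorm_le_partial_sum k (x : X) (C r : R) : 0 < C ->
  (forall N, C * p k (partial_sum 0 N N (J x)) <= r) -> C * p k x <= r.
Proof.
move=> C0 le_r; apply/ler_addgt0Pr => eps eps0.
have [N hN] := partial_sum_approx k x (divr_gt0 eps0 C0).
apply: le_trans (lerD (le_r N) (lexx eps)).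
rewrite -[X in _ + X](divfK (lt0r_neq0 C0)) [X in _ + X]mulrC -mulrDr ler_wpM2l ?(ltW C0) //.
by apply: le_trans (seminormB k x (partial_sum 0 N N (J x))) _; rewrite lerD2l ltW.
Qed.

(** Each truncation is a finite combination of vectors of zero seminorm. *)
Lemma seminorm_supported_null k (x : X) :
  (forall i, p k (e i) != 0 -> J x i = 0) -> p k x = 0.
Proof.
move=> x0; apply/le_anti; rewrite (seminorm_ge0 (induced_seminorm hp k)) andbT.
rewrite -[p k x]mul1r; apply: seminorm_le_partial_sum => // N; rewrite mul1r.
rewrite /partial_sum; elim/big_ind: _ => [|a b a0 b0|j _].
- by rewrite seminorm0.
- apply: le_trans (seminormD (induced_seminorm hp k) _ _) _.
  by rewrite -(addr0 0) lerD.
rewrite addr0 (seminormZ (induced_seminorm hp k)).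
have [->|/x0 ->] := eqVneq (p k (e (j%:Z - N%:Z))) 0; first by rewrite mulr0.
by rewrite modulus0 mul0r.
Qed.

(** * Truncations as elements of linear spans *)

Lemma lin_span0 (S : set X) : lin_span S 0.
Proof.
by exists 0%N, (fun=> 0), (fun=> 0); split; [case|rewrite big_ord0].
Qed.

Lemma lin_spanZ (S : set X) (a : K) x : S x -> lin_span S (a *: x).
Proof.
by move=> Sx; exists 1%N, (fun=> a), (fun=> x); rewrite big_ord1.
Qed.

Lemma lin_spanD (S : set X) x y :
  lin_span S x -> lin_span S y -> lin_span S (x + y).
Proof.
move=> [m [a [v [Sv ->]]]] [n [b [u [Su ->]]]].
exists (m + n)%N, (fun j => match fintype.split j with inl i => a i | inr i => b i end),
  (fun j => match fintype.split j with inl i => v i | inr i => u i end).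
split=> [j|]; first by case: fintype.split.
rewrite big_split_ord /=; congr (_ + _); apply: eq_bigr => i _.
  by rewrite (unsplitK (inl i)).
by rewrite (unsplitK (inr i)).
Qed.

Lemma partial_sum_lin_span (D : set int) m n (c : int -> K) :
  (forall i, ~ D i -> c i = 0) ->
  lin_span [set e i | i in D] (partial_sum 0 m n c).
Proof.
move=> c0; rewrite /partial_sum; elim/big_ind: _ => [||j _].
- exact: lin_span0.
- exact: lin_spanD.
rewrite addr0; have [Dj|/c0 ->] := pselect (D (j%:Z - m%:Z)).
  by apply: lin_spanZ; exists (j%:Z - m%:Z).
by rewrite scale0r; apply: lin_span0.
Qed.

(** * Multipliers bounded below and contractivity of coordinate projections *)

Hypothesis h1 : forall (x ax : X) (a : int -> K),
  (forall i, J ax i = a i * J x i) ->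
  forall k, p k ax >= inf [set modulus (a i) | i in [set: int]] * p k x.

Lemma seminorm_multiplier_ge (x ax : X) (a : int -> K) (M : R) k :
  (forall i, J ax i = a i * J x i) -> (forall i, M <= modulus (a i)) ->
  M * p k x <= p k ax.
Proof.
move=> axE Ma; apply: le_trans (h1 axE k).
rewrite ler_wpM2r ?(seminorm_ge0 (induced_seminorm hp k)) //.
apply: lb_le_inf; first by exists (modulus (a 0)), 0.
by move=> _ [i _ <-].
Qed.

Context {P : set int -> X -> X}.
Hypothesis JP : forall I x n, J (P I x) n = if n \in I then J x n else 0.

(* Multiplying [P_I x + eps P_{~I} x] by [1] on [I] and by [1/eps] off [I]
   gives back [x]; then let [eps] tend to [0]. *)
Lemma proj_contractive k I x : p k (P I x) <= p k x.
Proof.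
apply/ler_addgt0Pr => eps eps0.
set q := p k (P (~` I) x).
have q0 : 0 <= q by rewrite (seminorm_ge0 (induced_seminorm hp k)).
(* [d <= 1] makes the multiplier [1 / d] at least 1, and [d * q <= eps] controls the error; [q + 1]
   avoids dividing by zero. *)
pose d := Num.min 1 (eps / (q + 1)).
have d0 : 0 < d by rewrite lt_min ltr01 divr_gt0 // ltr_wpDl.
pose y := P I x + of_real s d *: P (~` I) x.
have yx : p k y <= p k x.
  rewrite -[p k y]mul1r.
  apply: (@seminorm_multiplier_ge _ _
    (fun i => if i \in I then 1 else (of_real s d)^-1)).
    move=> i; rewrite coordD coordZ !JP in_setC.
    case: (i \in I) => /=; first by rewrite mulr0 addr0 mul1r.
    rewrite add0r mulKf //; apply/eqP => d_eq0.
    by have := modulus_of_real (s := s) (ltW d0); rewrite d_eq0 modulus0; lra.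
  move=> i; case: ifP => _; first by rewrite modulus1.
  by rewrite modulusV modulus_of_real ?(ltW d0) // invf_ge1 // ge_min lexx.
apply: le_trans (seminormB k _ y) _; apply: lerD => //.
rewrite /y addrC addKr (seminormZ (induced_seminorm hp k)) modulus_of_real ?(ltW d0) //.
have : d <= eps / (q + 1) by rewrite ge_min lexx orbT.
rewrite ler_pdivlMr ?ltr_wpDl // => dq; rewrite -/q; nra.
Qed.

Lemma proj_split k I x : p k x <= p k (P I x) + p k (P (~` I) x).
Proof.
apply: le_trans (seminormD (induced_seminorm hp k) _ _).
rewrite le_eqVlt; apply/orP; left; apply/eqP; congr (p k _).
apply: coord_inj => i; rewrite coordD !JP in_setC.
by case: (i \in I); rewrite ?addr0 ?add0r.
Qed.

(** Since [I] and [L] may overlap, [P I x] is split off first and the remainder is then split along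
    [L]. What lies outside both is null for [p k], and the part in [L] is a projection of [P L x],
    hence no larger. *)
Lemma proj_cover_split k I L x : I `|` L = [set i | p k (e i) != 0] ->
  p k x <= p k (P I x) + p k (P L x).
Proof.
move=> IL; apply: le_trans (proj_split k I x) _; rewrite lerD2l.
apply: le_trans (proj_split k L _) _.
rewrite [X in _ + X]seminorm_supported_null ?addr0; last first.
  move=> i pi0; have : (I `|` L) i by rewrite IL.
  rewrite !JP !in_setC.
  by case=> /mem_set -> /=; rewrite ?if_same.
rewrite (_ : P L (P (~` I) x) = P (~` I) (P L x)); first exact: proj_contractive.
by apply: coord_inj => i; rewrite !JP; do 2 case: (_ \in _).
Qed.

(** * Growth of a weighted translate of a vector *)

Hypothesis h2 : forall k l, exists2 c : R, 0 < c &
  forall (n : int) (x y z : X),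
    closure (lin_span [set e i | i in [set i | p k (e i) != 0]]) x ->
    is_sumZ (fun i => J x i *: e (i + n)) y ->
    is_sumZ (fun i =>
      (J x i * of_real s (p l (e (i + n)) / p k (e i))) *: e i) z ->
    p l y >= c * p k z.

(* [J x * g] need not be the sequence of an element of [X], so [h2] is applied
   to truncations. *)
Lemma shift_growth k l : exists2 c : R, 0 < c &
  forall (d : int) (S : X -> X) (g : int -> K) (I : set int) (M : R) (x : X),
    (forall y i, J (S y) (i + d) = g i * J y i) ->
    0 < M -> I `<=` [set i | p k (e i) != 0] ->
    (forall i, I i -> M <= modulus (g i) * (p l (e (i + d)) / p k (e i))) ->
    c * M * p k (P I x) <= p l (S x).
Proof.
have [c c0 hc] := h2 k l; exists c => // d S g I M x SE M0 Isub IM.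
apply: seminorm_le_partial_sum; first exact: mulr_gt0.
move=> N; rewrite -mulrA.
pose rho i : K := of_real s (p l (e (i + d)) / p k (e i)).
have rhoE i : modulus (rho i) = p l (e (i + d)) / p k (e i).
  by rewrite modulus_of_real // divr_ge0 // (seminorm_ge0 (induced_seminorm hp _)).
pose b i : K := if - N%:Z <= i <= N%:Z then J (P I x) i else 0.
have b0 i : ~ I i -> b i = 0.
  by move=> nIi; rewrite /b JP memNset // if_same.
have b_out i : ~~ (- N%:Z <= i <= N%:Z) -> b i = 0 by rewrite /b => /negbTE ->.
have bE (f : int -> K) i : J (partial_sum 0 N N (fun j => f j * b j)) i = f i * b i.
  rewrite -[in LHS](addr0 i) coord_partial_sum.
  by case: ifPn => // /b_out ->; rewrite mulr0.
(* Hypothesis (2) is applied to [v], whose translate by [d] is [y]. As [y] is also a projection of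
   [S x], its seminorm is at most that of [S x]; [z] is the truncation [b] multiplied by
   [g * rho]. *)
pose v := partial_sum 0 N N (fun j => g j * b j).
pose z := partial_sum 0 N N (fun j => (g j * rho j) * b j).
pose y := P [set i | I (i - d) /\ - N%:Z <= i - d <= N%:Z] (S x).
have yE i : J y (i + d) = g i * b i.
  rewrite JP SE /b; case: ifPn; rewrite ?inE ?notin_setE /= addrK.
    by move=> [Ii ->]; rewrite JP mem_set.
  move=> nI; case: ifP => [hi|]; last by rewrite mulr0.
  by rewrite JP memNset ?mulr0 // => Ii; apply: nI.
have zM : M * p k (partial_sum 0 N N (J (P I x))) <= p k z.
  (* Off [I] the truncation vanishes, so the multiplier is free there; the value [M] preserves the
     lower bound. *)
  apply: (@seminorm_multiplier_ge _ _
    (fun i => if i \in I then g i * rho i else of_real s M)) => i.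
    rewrite bE -[i in J _ i]addr0 coord_partial_sum -/(b i).
    by case: ifPn => //; rewrite notin_setE => /b0 ->; rewrite !mulr0.
  case: ifP => [/set_mem/IM|_]; first by rewrite modulusM rhoE.
  by rewrite modulus_of_real // ltW.
apply: le_trans (proj_contractive l [set i | I (i - d) /\ - N%:Z <= i - d <= N%:Z] (S x)).
apply: le_trans (hc d v y z _ _ _); first by rewrite ler_wpM2l // ltW.
- apply/subset_closure/partial_sum_lin_span => i /= nD.
  by rewrite b0 ?mulr0 // => /Isub.
- apply: (is_sumZ_finite (N := N)) => i; first by move=> /b_out iN; rewrite bE iN mulr0.
  by rewrite yE bE.
- have zE : is_sumZ (fun i => (g i * rho i * b i) *: e (i + 0)) z.
    apply: (is_sumZ_finite (N := N)) => i; first by move=> /b_out iN; rewrite iN mulr0.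
    by rewrite addr0 bE.
  congr (is_sumZ _ z): zE; apply/funext => i.
  by rewrite addr0 bE mulrAC.
Qed.

(** * Iterates of the shift and of its inverse *)

Context {w : int -> K} {T Tinv : X -> X}.
Hypothesis hT : invertible_wshift J w T Tinv.

(** Surjectivity of [T]: the coordinate 1 of [e (i + 1)] at [i + 1] is [w i] times a coordinate of
    its preimage. *)
Lemma weight_neq0 i : w i != 0.
Proof.
have [TE _ TinvK] := hT; apply/eqP => w0.
have := TE (Tinv (e (i + 1))) => /(congr1 (@^~ (i + 1))) /=.
by rewrite TinvK Je eqxx /wshift addrK w0 mul0r => /eqP; rewrite oner_eq0.
Qed.

(** Evaluated at the target index, to have the shape [J (S y) (i + d) = g i * J y i] of the growth
    estimate with [d = n]; the inverse iterates fit it with [d = -n]. *)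
Lemma coord_iter_shift n x i :
  J (iter n T x) (i + n%:Z) = \prod_(j < n) w (i + j%:Z) * J x i.
Proof.
have [TE _ _] := hT.
elim: n => [|n IH]; first by rewrite big_ord0 mul1r addr0.
rewrite iterS TE /wshift big_ord_recr /= (_ : i + n.+1%:Z - 1 = i + n%:Z); last by lia.
by rewrite IH mulrA [X in X * _]mulrC.
Qed.

Lemma coord_inv_shift x i : J (Tinv x) i = (w i)^-1 * J x (i + 1).
Proof.
have [TE _ TinvK] := hT.
by rewrite -[in RHS](TinvK x) TE /wshift addrK mulKf // weight_neq0.
Qed.

Lemma coord_iter_inv_shift n x i :
  J (iter n Tinv x) (i - n%:Z) = (\prod_(j < n) w (i - j.+1%:Z))^-1 * J x i.
Proof.
elim: n => [|n IH]; first by rewrite big_ord0 invr1 mul1r subr0.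
rewrite iterS coord_inv_shift (_ : i - n.+1%:Z + 1 = i - n%:Z); last by lia.
by rewrite IH big_ord_recr /= invfM mulrA [X in X * _]mulrC.
Qed.

(** Comparing coordinates shows that [S] sends the normalised [e i] to a multiple of [e (i + d)];
    this covers both equalities in the statement of condition (ii). *)
Lemma seminorm_shifted_unit (d : int) (S : X -> X) (g : int -> K) k l i :
  (forall y i, J (S y) (i + d) = g i * J y i) -> p k (e i) != 0 ->
  modulus (g i) * (p l (e (i + d)) / p k (e i))
    = p l (S (of_real s (p k (e i))^-1 *: e i)).
Proof.
move=> SE pi0.
rewrite (_ : S _ = (g i * of_real s (p k (e i))^-1) *: e (i + d)); last first.
  apply: coord_inj => j; rewrite -(subrK d j) SE !coordZ !Je (inj_eq (addIr d)).
  by rewrite mulrA; case: eqP => [->|_]; rewrite ?mulr0.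
rewrite (seminormZ (induced_seminorm hp l)) modulusM modulus_of_real.
  by rewrite -mulrA [_ / _]mulrC.
by rewrite invr_ge0 (seminorm_ge0 (induced_seminorm hp k)).
Qed.

(** The constant [c] depends on [k] and [l] only, so it is the same for all [n] and [x]; this
    transfers uniformity from indices to vectors. *)
Lemma unif_growth k l (d : nat -> int) (S : nat -> X -> X) (g : nat -> int -> K)
    (I : set int) :
  (forall n y i, J (S n y) (i + d n) = g n i * J y i) ->
  I `<=` [set i | p k (e i) != 0] ->
  unif_to_pinfty I (fun n i =>
    modulus (g n i) * (p l (e (i + d n)) / p k (e i))) ->
  unif_to_pinfty [set x | 2^-1 <= p k (P I x)] (fun n x => p l (S n x)).
Proof.
move=> SE Isub gI M; have [c c0 hc] := shift_growth k l.
(* Chosen so that [c * M' / 2 = |M| + 1], which exceeds [M]. *)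
pose M' := 2 * (`|M| + 1) / c.
have M'0 : 0 < M' by rewrite divr_gt0 // mulr_gt0 // ltr_wpDl.
apply: filterS (gI M') => n gn x /= xI.
apply: lt_le_trans (hc (d n) (S n) (g n) I M' x (SE n) M'0 Isub _); last first.
  by move=> i /gn/ltW.
rewrite /M' (mulrC c) divfK ?gt_eqF //.
by have := ler_norm M; have := normr_ge0 M; nra.
Qed.

End SequenceSpace.

(** * Splittings of the unit sphere versus splittings of the index set *)

Theorem theorem3p3 (R : realType) (s : scalar_kind)
    (X : topologicalLmodType (scalar_field R s))
    (J : {linear X -> (int -> (scalar_field R s)^o)})
    (e : int -> X) (p : nat -> X -> R) (w : int -> scalar_field R s)
    (T Tinv : X -> X)
    (hX : frechet_sequence_space J)
    (he : unconditional_basis J e)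
    (hp : induced_by_seminorms p)
    (hT : invertible_wshift J w T Tinv)
    (h1 : forall (x ax : X) (a : int -> scalar_field R s),
      (forall i, J ax i = a i * J x i) ->
      forall k, p k ax >= inf [set modulus (a i) | i in [set: int]] * p k x)
    (h2 : forall k l, exists2 c : R, 0 < c &
      forall (n : int) (x y z : X),
        closure (lin_span [set e i | i in [set i | p k (e i) != 0]]) x ->
        is_sumZ (fun i => J x i *: e (i + n)) y ->
        is_sumZ (fun i =>
          (J x i * of_real s (p l (e (i + n)) / p k (e i))) *: e i) z ->
        p l y >= c * p k z) :
  (forall k l (n : nat) (i : int), p k (e i) != 0 ->
    modulus (\prod_(j < n) w (i + j%:Z)) * (p l (e (i + n%:Z)) / p k (e i))
      = p l (iter n T (of_real s (p k (e i))^-1 *: e i)) /\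
    (modulus (\prod_(j < n) w (i - j.+1%:Z)))^-1
        * (p l (e (i - n%:Z)) / p k (e i))
      = p l (iter n Tinv (of_real s (p k (e i))^-1 *: e i))) /\
  (unif_top_expansive p T Tinv <->
   forall k, exists l (Ip Im : set int),
     [/\ Ip `|` Im = [set i | p k (e i) != 0],
         unif_to_pinfty Ip (fun n i =>
           modulus (\prod_(j < n) w (i + j%:Z))
             * (p l (e (i + n%:Z)) / p k (e i))) &
         unif_to_pinfty Im (fun n i =>
           (modulus (\prod_(j < n) w (i - j.+1%:Z)))^-1
             * (p l (e (i - n%:Z)) / p k (e i)))]).
Proof.
have [_ Jinj _] := hX; have [[Je Jbasis] [P [JP _]]] := he.
have normT k l n i (pi0 : p k (e i) != 0) := seminorm_shifted_unit Jinj Je hp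
  l (coord_iter_shift hT n) pi0.
have normTinv k l n i : p k (e i) != 0 ->
    (modulus (\prod_(j < n) w (i - j.+1%:Z)))^-1
      * (p l (e (i - n%:Z)) / p k (e i))
    = p l (iter n Tinv (of_real s (p k (e i))^-1 *: e i)).
  move=> pi0; rewrite -modulusV.
  exact: (seminorm_shifted_unit Jinj Je hp l (coord_iter_inv_shift Je hT n) pi0).
split=> [k l n i pi0|]; first by split; [exact: normT|exact: normTinv].
split=> [expT k|gT k].
  have [l [A [B [AB TA TB]]]] := expT k.
  (* An index is assigned to the side of the sphere on which its normalised canonical vector lies,
     possibly to both. *)
  pose unit_vec i := of_real s (p k (e i))^-1 *: e i.
  exists l, [set i | p k (e i) != 0 /\ A (unit_vec i)],
    [set i | p k (e i) != 0 /\ B (unit_vec i)]; split.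
  - apply/seteqP; split=> i /=; first by case=> -[].
    move=> pi0.
    suff : (A `|` B) (unit_vec i) by case=> ?; [left|right].
    rewrite -AB /= (seminormZ (induced_seminorm hp k)) modulus_of_real ?mulVf //.
    by rewrite invr_ge0 (seminorm_ge0 (induced_seminorm hp k)).
  - by move=> M; apply: filterS (TA M) => n TAn i [pi0 /TAn]; rewrite normT.
  - by move=> M; apply: filterS (TB M) => n TBn i [pi0 /TBn]; rewrite normTinv.
have [l [Ip [Im [IpIm gp gm]]]] := gT k.
(* The two projections of a unit vector have seminorms adding up to at least 1, so one of them
   reaches one half. *)
exists l, [set x | p k x = 1 /\ 2^-1 <= p k (P Ip x)],
  [set x | p k x = 1 /\ 2^-1 <= p k (P Im x)]; split.
- apply/seteqP; split=> x /=; last by case=> -[].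
  move=> x1; have := proj_cover_split Jinj Jbasis hp h1 JP x IpIm; rewrite x1.
  have [xp _|xp xm] := lerP 2^-1 (p k (P Ip x)); first by left.
  by right; split=> //; lra.
- have Tp := unif_growth Jinj Je Jbasis hp h1 JP h2 (coord_iter_shift hT)
    (_ : Ip `<=` [set i | p k (e i) != 0]) gp.
  move=> M; apply: filterS (Tp _ M) => [n Tn x [_ /Tn]//|].
  by rewrite -IpIm; exact: subsetUl.
- have gm' : unif_to_pinfty Im (fun n i =>
      modulus (\prod_(j < n) w (i - j.+1%:Z))^-1 * (p l (e (i - n%:Z)) / p k (e i))).
    by move=> M; apply: filterS (gm M) => n gn i /gn; rewrite modulusV.
  have Tm := unif_growth Jinj Je Jbasis hp h1 JP h2
    (d := fun n => - n%:Z) (coord_iter_inv_shift Je hT)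
    (_ : Im `<=` [set i | p k (e i) != 0]) gm'.
  move=> M; apply: filterS (Tm _ M) => [n Tn x [_ /Tn]//|].
  by rewrite -IpIm; exact: subsetUr.
Qed.
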